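(* For every integer $n\ge 0$, $$8\sum_{\substack{j+k(k+1)/2=n\\ j,k\geq 0}}\widetilde{\sigma}(j)=\begin{cases}(2r+1)^2, & \text{if } n=r(r+1)/2 \text{ for some integer } r\ge 0,\\ 0,&\text{otherwise},\end{cases}$$ where the sum is over pairs of nonnegative integers $(j,k)$.
   Context: For a positive integer $n$, $\widetilde{\sigma}(n)=\sum_{d\mid n}(-1)^{d-1}d$ (sum over positive divisors), and by convention $\widetilde{\sigma}(0)=\frac18$. *)

(* Defs.v *)
From mathcomp Require Import all_boot all_order all_algebra.
Set Implicit Arguments.
Unset Strict Implicit.
Unset Printing Implicit Defensive.
Import GRing.Theory.
Local Open Scope ring_scope.

Definition triangular (k : nat) : nat := ((k * (k + 1)) %/ 2)%N.

(* [divisors n] only lists divisors for n > 0, so n = 0 is set by hand; since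
   d > 0, the truncated [d - 1] is the true predecessor. *)
Definition sigma_tilde (n : nat) : rat :=
  if n == 0%N then 1 / 8
  else \sum_(d <- divisors n) (-1) ^+ (d - 1) * d%:R.

(* The sum over all pairs (j, k) of naturals with j + k(k+1)/2 = n; every such
   pair has j <= n and k <= k(k+1)/2 <= n, so the bounds drop no pair. *)
Definition sigma_tilde_sum (n : nat) : rat :=
  \sum_(j < n.+1) \sum_(k < n.+1 | (j + triangular k == n)%N) sigma_tilde j.

(* Main.v *)
(** With psi = sum_k X^(k(k+1)/2), Gauss's product
    psi = prod_k (1 - X^(2k)) / (1 - X^(2k-1)) has logarithmic derivative
    X psi' / psi = sum_(n >= 1) sigma_tilde(n) X^n.  Comparing coefficients in
    X psi' = psi * sum_n sigma_tilde(n) X^n, with 8 * k(k+1)/2 + 1 = (2k+1)^2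
    accounting for sigma_tilde(0) = 1/8, gives the claim.  Modulo X^(2N+1),
    which suffices for the coefficients up to 2N, Gauss's product is a polynomial
    congruence and follows from Shanks's finite identity. *)
Require Import Defs.
From mathcomp Require Import all_boot all_order all_algebra.
From mathcomp Require Import ring zify.
Set Implicit Arguments.
Unset Strict Implicit.
Unset Printing Implicit Defensive.
Import GRing.Theory.
Local Open Scope ring_scope.

(** * Triangular numbers *)

Lemma double_triangular k : ((triangular k).*2 = k * k.+1)%N.
Proof.
rewrite /triangular addn1 divn2 -[RHS]odd_double_half.
by rewrite oddM /= andbN.
Qed.

Lemma triangular_inj : injective triangular.
Proof.
move=> k l /(congr1 double); rewrite !double_triangular => kl.
have [] : (k <= l)%N /\ (l <= k)%N by split; nia.
by move=> *; apply/eqP; rewrite eqn_leq; apply/andP.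
Qed.

Lemma leq_triangular k : (k <= triangular k)%N.
Proof. by rewrite -leq_double double_triangular; nia. Qed.

(** * Shanks's finite identity *)

Section Shanks.
Variables (R : comNzRingType) (q : R).

Definition odd_prod n := \prod_(k < n) (1 - q ^+ k.*2.+1).
Definition even_prod s n := \prod_(s <= k < n) (1 - q ^+ k.*2).
(** Shanks's sum of [P_n / P_s * q ^+ (s * n.*2.+1)], where [P_s] is the partial Gauss product,
    multiplied by [odd_prod n] to clear denominators. *)
Definition shanks n :=
  \sum_(0 <= s < n.+1) odd_prod s * even_prod s.+1 n.+1 * q ^+ (s * n.*2.+1).

(** The two new exponents are the triangular numbers of index 2n+1 and 2n+2, which drives the
    induction in [shanks_identity]. *)
Lemma shanksS n :
  shanks n.+1 = (1 - q ^+ n.*2.+1) * shanks n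
    + odd_prod n.+1 * (q ^+ (n.+1 * n.*2.+1) + q ^+ (n.+1 * n.*2.+3)).
Proof.
(* [V] is Shanks's telescoping antidifference. *)
pose V s := odd_prod s * even_prod s n.+1 * q ^+ (s * n.*2.+1).
have stepV s : (0 <= s < n.+1)%N ->
    odd_prod s * even_prod s.+1 n.+2 * q ^+ (s * n.+1.*2.+1)
    = (1 - q ^+ n.*2.+1) *
        (odd_prod s * even_prod s.+1 n.+1 * q ^+ (s * n.*2.+1))
      + (V s.+1 - V s).
  move=> /andP[_ lt_sn]; rewrite /V /odd_prod big_ord_recr /= /even_prod.
  rewrite big_nat_recr //= (big_ltn lt_sn).
  have -> : (s * n.+1.*2.+1 = s * n.*2.+1 + s.*2)%N by lia.
  have -> : (s.+1 * n.*2.+1 = s * n.*2.+1 + n.*2.+1)%N by lia.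
  have -> : (n.+1.*2 = n.*2.+1 + 1)%N by lia.
  have -> : (s.*2.+1 = s.*2 + 1)%N by lia.
  rewrite !exprD.
  move: (\prod_(s.+1 <= _ < _) _) (\prod_(_ < s) _) => a b.
  move: (q ^+ (s * _)) (q ^+ s.*2) (q ^+ n.*2.+1) (q ^+ 1) => c d e f.
  by ring.
rewrite /shanks big_nat_recr //= (eq_big_nat _ _ stepV) big_split /=.
rewrite telescope_sumr // -mulr_sumr -addrA; congr (_ + _).
(* The factor k = 0 of [even_prod 0] is 1 - q^0 = 0. What survives is [V n.+1] and the last summand,
   one new power each. *)
have V0 : V 0%N = 0.
  by rewrite /V /even_prod big_ltn // double0 expr0 subrr mul0r mulr0 mul0r.
rewrite V0 /V /even_prod subr0 !(@big_geq _ _ _ n.+1) ?(@big_geq _ _ _ n.+2) //.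
by rewrite doubleS !mulr1 mulrDr.
Qed.

Lemma shanks_identity n :
  odd_prod n * \sum_(s < n.*2.+1) q ^+ triangular s = shanks n.
Proof.
elim: n => [|n IHn].
  by rewrite /shanks big_ord1 big_nat1 /odd_prod /even_prod big_ord0 big_geq // !mul1r.
rewrite shanksS -IHn doubleS 2!big_ord_recr /=.
have -> : triangular n.*2.+1 = (n.+1 * n.*2.+1)%N.
  by apply: double_inj; rewrite double_triangular; lia.
have -> : triangular n.*2.+2 = (n.+1 * n.*2.+3)%N.
  by apply: double_inj; rewrite double_triangular; lia.
have -> : odd_prod n.+1 = odd_prod n * (1 - q ^+ n.*2.+1) by exact: big_ord_recr.
by ring.
Qed.

End Shanks.

(** * Congruences modulo X^M and Lambert series *)

Section Truncation.
Variable M : nat.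
Implicit Types p q r : {poly rat}.

Definition eqtrunc p q := 'X^M %| p - q.

Lemma eqtruncP p q : reflect (exists r, p = q + r * 'X^M) (eqtrunc p q).
Proof.
apply: (iffP (dvdpP _ _)) => -[r Er]; exists r; last by rewrite Er addrC addKr.
by rewrite -Er addrC subrK.
Qed.

Lemma eqtrunc_coef p q i : eqtrunc p q -> (i < M)%N -> p`_i = q`_i.
Proof.
by move=> /eqtruncP[r ->] lt_iM; rewrite coefD coefMXn lt_iM addr0.
Qed.

Lemma theta_Xn n : 'X * ('X^n : {poly rat})^`() = n%:R * 'X^n.
Proof.
case: n => [|n]; first by rewrite derivXn mulr0n mulr0 mul0r.
by rewrite derivXn -mulr_natl mulrCA -exprS.
Qed.

(** Unlike the plain derivative, which loses a degree, X d/dX maps multiples of X^M to multiples of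
    X^M. *)
Lemma eqtrunc_theta p q : eqtrunc p q -> eqtrunc ('X * p^`()) ('X * q^`()).
Proof.
move=> /eqtruncP[r ->]; apply/eqtruncP; exists ('X * r^`() + r * M%:R).
rewrite derivD derivM !mulrDr [X in _ + (_ + X)]mulrCA theta_Xn.
by move: r^`() q^`() ('X^M) => *; ring.
Qed.

(* 'X^a / (1 - 'X^a) truncated. *)
Definition lambert a : {poly rat} := \sum_(m < M) 'X^(a * m.+1).

Lemma lambertE a : (0 < a)%N -> eqtrunc ((1 - 'X^a) * lambert a) 'X^a.
Proof.
(* The product telescopes to X^a - X^(a(M+1)), and a(M+1) >= M. *)
move=> a_gt0; apply/eqtruncP; exists (- 'X^(a * M.+1 - M)).
rewrite mulNr -exprD subnK; last by nia.
rewrite mulr_sumr.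
rewrite (eq_bigr (fun m : 'I_M => 'X^(a * m.+1) - 'X^(a * m.+2))); last first.
  by move=> m _; rewrite mulrBl mul1r -exprD -mulnS.
rewrite -(big_mkord predT (fun m => 'X^(a * m.+1) - 'X^(a * m.+2))).
rewrite -[LHS]opprK -sumrN; under eq_bigr do rewrite opprB.
by rewrite telescope_sumr // opprB muln1.
Qed.

(** A positive j <= M has cofactor j/a <= M, so the M terms of [lambert] suffice. *)
Lemma coef_lambert a j : (0 < a)%N -> (j <= M)%N ->
  (lambert a)`_j = ((0 < j) && (a %| j))%N%:R.
Proof.
move=> a_gt0 le_jM; rewrite coef_sum; under eq_bigr do rewrite coefXn.
case: (boolP (_ && _)) => [/andP[j_gt0 /dvdnP[[|m] Ej]] | nj]; first by lia.
  have lt_mM : (m < M)%N by nia.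
  rewrite (bigD1 (Ordinal lt_mM)) //= Ej mulnC eqxx big1 ?addr0 // => i.
  by rewrite -val_eqE /= eqn_pmul2l // eqSS eq_sym => /negPf->.
rewrite big1 // => m _; case: eqP => // Ej; case/negP: nj.
by rewrite Ej muln_gt0 a_gt0 dvdn_mulr.
Qed.

(** Logarithmic differentiation without division: each factor contributes -a X^a / (1 - X^a), and
    the Leibniz rule gives the induction. *)
Lemma theta_prod I (s : seq I) (a : I -> nat) : (forall i, 0 < a i)%N ->
  eqtrunc ('X * (\prod_(i <- s) (1 - 'X^(a i)))^`())
          (- (\prod_(i <- s) (1 - 'X^(a i)) * \sum_(i <- s) (a i)%:R * lambert (a i))).
Proof.
move=> a_gt0; elim: s => [|i s /eqtruncP[r Er]].
  by rewrite !big_nil derivC !mulr0 oppr0 /eqtrunc subrr dvdp0.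
have /eqtruncP[t Et] := lambertE (a_gt0 i).
rewrite !big_cons; move: Er Et; set P := \prod_(_ <- _) _; set S := \sum_(_ <- _) _.
move=> Er Et; apply/eqtruncP; exists ((a i)%:R * t * P + (1 - 'X^(a i)) * r).
have -> : 'X * ((1 - 'X^(a i)) * P)^`()
    = - ((a i)%:R * 'X^(a i)) * P + (1 - 'X^(a i)) * ('X * P^`()).
  rewrite derivM derivB derivC sub0r mulrDr mulrA mulrN theta_Xn mulNr.
  by rewrite [X in _ + X]mulrCA.
rewrite Er; move: Et; move: ('X^(a i)) ('X^M) (lambert _) => x y l Et.
(* By [Et], the leading x equals (1 - x) l - t y, which brings out the factor 1 - x. *)
transitivity (- ((a i)%:R * ((1 - x) * l - t * y)) * P + (1 - x) * (- (P * S) + r * y)).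
  by rewrite Et addrK.
by ring.
Qed.

End Truncation.

(** * Gauss's product and its logarithmic derivative *)

Definition psi N : {poly rat} := \sum_(s < N.*2.+1) 'X^(triangular s).

(** The index d stands for the divisor d+1, hence the sign (-1)^d. The constant term is 0, not
    1/8. *)
Definition sigma_poly N : {poly rat} :=
  \sum_(d < N.*2) (-1) ^+ d * (d.+1%:R * lambert N.*2.+1 d.+1).

(** Only the summand s = 0 of [shanks N] survives: the others contain X^(s(2N+1)) with s >= 1. *)
Lemma gauss_trunc N : eqtrunc N.*2.+1 (odd_prod 'X N * psi N) (even_prod 'X 1 N.+1).
Proof.
rewrite shanks_identity /shanks big_ltn // /eqtrunc.
rewrite {1}/odd_prod big_ord0 mul1r mul0n mulr1 addrC addrA addNr add0r.
rewrite big_add1; apply: (big_ind (fun p => 'X^(N.*2.+1) %| p)) => [|p q|s _]; first exact: dvdp0.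
  exact: dvdp_add.
by rewrite mulSn exprD mulrCA dvdp_mulr ?dvdpp.
Qed.

Lemma sum_alternating (R : pzRingType) (F : nat -> R) N :
  \sum_(d < N.*2) (-1) ^+ d * F d = \sum_(k < N) F k.*2 - \sum_(k < N) F k.*2.+1.
Proof.
elim: N => [|N IHN]; first by rewrite !big_ord0 subr0.
rewrite doubleS !big_ord_recr /= IHN exprS -signr_odd odd_double expr0.
by rewrite mulr1 mul1r mulN1r opprD addrACA addrA.
Qed.

(** Write T for X d/dX. From D psi = E, T D = - D A and T E = - E B modulo X^(2N+1) follows D (T
    psi) = D (A - B) psi, and D cancels. Here A - B is [sigma_poly N] split by the parity of d. *)
Lemma theta_psi N : eqtrunc N.*2.+1 ('X * (psi N)^`()) (sigma_poly N * psi N).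
Proof.
have theta_odd := theta_prod N.*2.+1 (index_enum 'I_N) (fun k => ltn0Sn k.*2).
have theta_even := theta_prod N.*2.+1 (index_enum 'I_N) (fun k => ltn0Sn k.*2.+1).
have := gauss_trunc N; have := eqtrunc_theta (gauss_trunc N).
have -> : even_prod 'X 1 N.+1 = \prod_(k < N) (1 - 'X^(k.+1.*2)) :> {poly rat}.
  by rewrite /even_prod big_add1 big_mkord.
rewrite /sigma_poly (sum_alternating (fun d => d.+1%:R * _ d.+1)) /odd_prod; move: theta_odd theta_even.
set D := \prod_(_ <- _) _; set A := \sum_(_ <- _) _.
set E := \prod_(_ <- _) _; set B := \sum_(_ <- _) _.
rewrite derivM => /eqtruncP[r1 E1] /eqtruncP[r2 E2] /eqtruncP[r3 E3] /eqtruncP[r4 E4].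
(* D has constant term 1, so it is coprime to every power of X. *)
have coDX : coprimep 'X^(N.*2.+1) D.
  apply/coprimep_expl; rewrite coprimep_sym -['X]subr0 coprimep_XsubC.
  rewrite /root horner_prod big1 ?oner_eq0 // => k _.
  by rewrite !hornerE expr0n subr0.
rewrite /eqtrunc -(Gauss_dvdpr _ coDX).
apply/dvdpP; exists (r2 + r3 - r1 * psi N + r4 * B).
move: E1 E2 E3 E4; move: 'X^(_) (psi N)^`() E^`() D^`() => Y psi' E' D' E1 E2 E3 E4.
have Dpsi' : D * ('X * psi') = - (E * B) + (r2 + r3) * Y + (D * A - r1 * Y) * psi N.
  have -> : D * ('X * psi') = 'X * (D' * psi N + D * psi') - 'X * D' * psi N by ring.
  by rewrite E3 E2 E1; ring.
rewrite mulrBr Dpsi'.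
transitivity (B * (D * psi N) - E * B + (r2 + r3) * Y - r1 * Y * psi N); first by ring.
by rewrite E4; ring.
Qed.

(** * Comparison of coefficients *)

Lemma sum_divisors (F : nat -> rat) n K : (0 < n < K)%N ->
  \sum_(d <- divisors n) F d = \sum_(1 <= d < K | (d %| n)%N) F d.
Proof.
move=> /andP[n_gt0 lt_nK]; rewrite -[RHS]big_filter; apply: perm_big.
apply: uniq_perm; rewrite ?divisors_uniq ?filter_uniq ?iota_uniq // => d.
rewrite mem_filter mem_index_iota -dvdn_divisors //.
have [d_dvd /=|//] := boolP (d %| n)%N.
by rewrite (dvdn_gt0 n_gt0) // (leq_ltn_trans (dvdn_leq n_gt0 d_dvd)).
Qed.

Lemma coef_sigma_poly N j : (j <= N.*2)%N ->
  (sigma_poly N)`_j = sigma_tilde j - (j == 0%N)%:R / 8.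
Proof.
move=> le_j; rewrite coef_sum.
have term (d : 'I_(N.*2)) : ((-1) ^+ d * (d.+1%:R * lambert N.*2.+1 d.+1))`_j
    = (-1) ^+ (d.+1 - 1) * d.+1%:R * ((0 < j) && (d.+1 %| j))%N%:R.
  rewrite mulrA; have -> : (-1) ^+ d * d.+1%:R = ((-1) ^+ d * d.+1%:R)%:P :> {poly rat}.
    by rewrite polyCM polyC_exp polyCN polyC1 polyC_natr.
  by rewrite coefCM coef_lambert ?subn1 // ltnW.
rewrite (eq_bigr _ (fun d _ => term d)) /sigma_tilde.
case: (posnP j) => [-> | j_gt0].
  by rewrite big1 ?subrr // => d _; rewrite mulr0.
rewrite mul0r subr0 (@sum_divisors _ _ N.*2.+1) ?j_gt0 // big_add1 big_mkord [RHS]big_mkcond.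
by apply: eq_bigr => d _; case: ifP; rewrite ?mulr1 ?mulr0.
Qed.

(** Since k <= [triangular k], indices above m contribute nothing; this reconciles the range of
    [psi] with that of [sigma_tilde_sum]. *)
Lemma sum_triangular m K : (m < K)%N ->
  \sum_(k < K) (triangular k == m)%:R = \sum_(k < m.+1) (triangular k == m)%:R :> rat.
Proof.
move=> lt_mK; rewrite [RHS](big_ord_widen _ (fun k => (triangular k == m)%:R) lt_mK).
rewrite [RHS]big_mkcond; apply: eq_bigr => k _; case: ltnP => // lt_mk.
by rewrite gtn_eqF // (leq_trans lt_mk) ?leq_triangular.
Qed.

Lemma coef_psi N m K : (m <= N.*2)%N -> (m < K)%N ->
  (psi N)`_m = \sum_(k < K) (triangular k == m)%:R.
Proof.
move=> le_mN lt_mK; rewrite sum_triangular // -(@sum_triangular m N.*2.+1) //.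
by rewrite coef_sum; apply: eq_bigr => k _; rewrite coefXn eq_sym.
Qed.

Lemma sigma_tilde_sumE n :
  8 * sigma_tilde_sum n = (8 * n%:R + 1) * \sum_(k < n.+1) (triangular k == n)%:R.
Proof.
have le_n2 j : (j <= n -> j <= n.*2)%N by lia.
have := eqtrunc_coef (theta_psi n) (le_n2 n (leqnn n)).
rewrite mulrC coefMX coefM.
(* For n = 0 both sides vanish, so the truncated [n.-1] is harmless. *)
have -> : (if n == 0%N then 0 else (psi n)^`()`_n.-1) = n%:R * (psi n)`_n.
  by case: (n) => [|m]; rewrite ?mul0r // coef_deriv mulr_natl.
move=> coefE.
have -> : sigma_tilde_sum n = \sum_(j < n.+1) sigma_tilde j * (psi n)`_(n - j).
  apply: eq_bigr => j _; rewrite (@coef_psi _ _ n.+1); [|lia|lia].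
  rewrite mulr_sumr big_mkcond; apply: eq_bigr => k _.
  have -> : (triangular k == n - j)%N = (j + triangular k == n)%N.
    by have := ltn_ord j; lia.
  by case: eqP; rewrite ?mulr1 ?mulr0.
(* The term j = 0 supplies the 1/8 absent from [sigma_poly], giving the factor n + 1/8. *)
have -> : \sum_(j < n.+1) sigma_tilde j * (psi n)`_(n - j)
    = n%:R * (psi n)`_n + 1 / 8 * (psi n)`_n.
  rewrite coefE (eq_bigr (fun j : 'I_n.+1 => (sigma_poly n)`_j * (psi n)`_(n - j)
      + (j == 0%N :> nat)%:R / 8 * (psi n)`_(n - j))); last first.
    move=> j _; have le_jn : (j <= n)%N by rewrite -ltnS.
    by rewrite (coef_sigma_poly (le_n2 _ le_jn)) -mulrDl subrK.
  rewrite big_split; congr (_ + _); rewrite big_ord_recl.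
  by rewrite big1 /= ?addr0 ?subn0 ?eqxx // => j _; rewrite !mul0r.
by rewrite -(coef_psi (le_n2 n _)) //; field.
Qed.

Theorem theorem5p1 (n : nat) :
  (forall r : nat, n = triangular r ->
     8 * sigma_tilde_sum n = (2 * r%:R + 1) ^+ 2) /\
  (~ (exists r : nat, n = triangular r) ->
     8 * sigma_tilde_sum n = 0).
Proof.
split=> [r Er | not_tri]; rewrite sigma_tilde_sumE.
  have lt_rn : (r < n.+1)%N by rewrite Er ltnS leq_triangular.
  (* By injectivity of [triangular], only k = r contributes; then 8n + 1 = 4r(r+1) + 1 =
     (2r+1)^2. *)
  rewrite (bigD1 (Ordinal lt_rn)) //= -Er eqxx big1 => [|k]; last first.
    rewrite -val_eqE /= => /eqP neq_kr; case: eqP => // Ek.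
    by case: neq_kr; apply: triangular_inj; rewrite Ek.
  have : (n.*2 = r * r.+1)%N by rewrite Er double_triangular.
  move=> /(congr1 (fun m => m%:R : rat)); rewrite -mul2n !natrM -natr1 => En.
  rewrite addr0 mulr1; transitivity (4 * (2 * n%:R) + 1 : rat); first by ring.
  by rewrite En; ring.
rewrite big1 ?mulr0 // => k _; case: eqP => // Ek.
by case: not_tri; exists k.
Qed.
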